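(* Classically, the notions of oo-lattice, overlap Heyting algebra (o-Ha), overlap Boolean algebra (o-Ba) and Boolean algebra all coincide: every oo-lattice is an o-Ha and an o-Ba, its underlying lattice is a Boolean algebra with complement $-$ and its overlap relation is $p\bowtie q\iff p\wedge q\ne0$; and every Boolean algebra, with $p\bowtie q:\iff p\wedge q\neq0$, is an o-Ba (hence an o-Ha and an oo-lattice).
   Context: ''Classically'' means in a classical setting (law of excluded middle and powerset axiom available). An overlap lattice with opposite (oo-lattice) is a quadruple $(\mathcal P,\le,\bowtie,-)$ where $(\mathcal P,\le)$ is a bounded lattice (with bottom $0$ and top $1$), $-$ is a pseudo-complement operation ($p\wedge q=0\iff p\le -q$) and $\bowtie$ is a binary relation on $\mathcal P$ such that for all $p,q$: (symmetry) $p\bowtie q\Rightarrow q\bowtie p$; (meet closure) $p\bowtie q\Rightarrow p\bowtie(p\wedge q)$; (splitting of existing joins) whenever $(q_i)_{i\in I}$ is a set-indexed family whose join $\bigvee_{i\in I}q_i$ exists, $p\bowtie\bigvee_{i\in I}q_i\iff(\exists i\in I)(p\bowtie q_i)$; (density) $(\forall r\in\mathcal P)(r\bowtie p\Rightarrow r\bowtie q)\Rightarrow p\le q$. All oo-lattices are assumed set-based: there is a set $S$ of elements (a base) such that for every $p$ the join of $\{a\in S\mid a\le p\}$ exists and equals $p$. An overlap Heyting algebra (o-Ha) is an oo-lattice whose underlying lattice is a Heyting algebra. An overlap Boolean algebra (o-Ba) is an o-Ha whose underlying lattice is a Boolean algebra. *)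

(* Defs.v *)
From HB Require Import structures.
From mathcomp Require Import all_boot all_order.
From mathcomp Require Import boolp classical_sets.

Set Implicit Arguments.
Unset Strict Implicit.
Unset Printing Implicit Defensive.

Import Order.Theory.
Local Open Scope order_scope.

(* In a join [isLub (range q) s], "s is the least upper bound of the family
   q", existence of the join is part of the hypothesis: L need not be
   complete.  The empty family is allowed, so 0 overlaps nothing. *)
Record is_oo_lattice (d : Order.disp_t) (L : tbLatticeType d)
    (ov : L -> L -> Prop) (opp : L -> L) : Prop := OOLattice {
  oo_pseudocompl : forall p q : L, p `&` q = \bot <-> p <= opp q;
  oo_sym : forall p q : L, ov p q -> ov q p;
  oo_meet : forall p q : L, ov p q -> ov p (p `&` q);
  oo_split : forall (I : Type) (q : I -> L) (s : L), isLub (range q) s ->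
    forall p : L, ov p s <-> exists i : I, ov p (q i);
  oo_density : forall p q : L, (forall r : L, ov r p -> ov r q) -> p <= q;
  oo_set_based : exists S : set L,
    forall p : L, isLub [set a | S a /\ a <= p] p
}.

Definition is_heyting (d : Order.disp_t) (L : tbLatticeType d) : Prop :=
  exists imp : L -> L -> L, forall p q r : L, p `&` q <= r <-> p <= imp q r.

(* L is a Boolean algebra and [compl] is its complement.  This is a predicate
   on a given bounded lattice; [ctbDistrLatticeType] bundles the same axioms
   as a structure (see the two lemmas below). *)
Definition is_boolean_with (d : Order.disp_t) (L : tbLatticeType d)
    (compl : L -> L) : Prop :=
  left_distributive (@Order.meet d L) (@Order.join d L) /\
  forall p : L, p `&` compl p = \bot /\ p `|` compl p = \top.

Definition is_boolean (d : Order.disp_t) (L : tbLatticeType d) : Prop :=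
  exists compl : L -> L, is_boolean_with compl.

Definition is_oHa (d : Order.disp_t) (L : tbLatticeType d)
    (ov : L -> L -> Prop) (opp : L -> L) : Prop :=
  is_oo_lattice ov opp /\ is_heyting L.

Definition is_oBa (d : Order.disp_t) (L : tbLatticeType d)
    (ov : L -> L -> Prop) (opp : L -> L) : Prop :=
  is_oHa ov opp /\ is_boolean L.

Lemma ctbDistrLattice_is_boolean (d : Order.disp_t)
    (B : ctbDistrLatticeType d) : is_boolean_with (@Order.compl d B).
Proof.
split; first exact: meetUl.
by move=> p; rewrite meetxC joinxC.
Qed.

Lemma is_boolean_ctbDistrLattice (d : Order.disp_t) (L : tbLatticeType d)
    (compl : L -> L) : is_boolean_with compl ->
  exists B : ctbDistrLatticeType d,
    existT (fun M : tbLatticeType d => M -> M) B (@Order.compl d B) =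
    existT (fun M : tbLatticeType d => M -> M) L compl.
Proof.
case=> dist cE.
have [T eT] : exists T : tbDistrLatticeType d, T = L :> tbLatticeType d.
  pose D := Order.Lattice_Meet_isDistrLattice.Build d L dist.
  exists (HB.pack_for (tbDistrLatticeType d) (Order.TBLattice.sort L) L D).
  by case: L compl dist cE @D.
case: L / eT compl dist cE => compl _ cE.
pose C := Order.TBDistrLattice_hasComplement.Build d T
  (fun p => (cE p).2) (fun p => (cE p).1).
exists (HB.pack_for (ctbDistrLatticeType d) (Order.TBDistrLattice.sort T) T C).
by [].
Qed.

(* Main.v *)
Require Import Defs.
From HB Require Import structures.
From mathcomp Require Import all_boot all_order.
From mathcomp Require Import boolp classical_sets.
Local Open Scope order_scope.

(** Density applied to a nonzero [r] gives some [x] overlapping [r], and the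
    other overlap axioms turn this into [ov r r]; hence [ov p q] holds exactly
    when [p `&` q] is nonzero.  Density then says that
    [opp (opp q) <= q], and a bounded lattice with an involutive
    pseudo-complement is a Heyting algebra, hence distributive, hence Boolean. *)

Import Order.Theory.

Section PseudoComplement.
Variables (d : Order.disp_t) (L : tbLatticeType d) (opp : L -> L).
Hypothesis pseudocompl : forall p q : L, p `&` q = \bot <-> p <= opp q.

Lemma meet_pseudocompl p : p `&` opp p = \bot.
Proof. by rewrite meetC; apply/pseudocompl. Qed.

Hypothesis opp_involutive : forall p, opp (opp p) <= p.

Lemma le_meet_pseudocompl p q : p <= q <-> p `&` opp q = \bot.
Proof.
split=> [le_pq|/pseudocompl le_p]; last exact: le_trans le_p (opp_involutive q).
apply: le_anti; rewrite le0x andbT -(meet_pseudocompl q).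
exact: leI2.
Qed.

(** The implication is the classical one, [not (q and not r)]: both sides say that [p], [q] and
    [opp r] meet in [\bot]. *)
Lemma pseudocompl_impE p q r : p `&` q <= r <-> p <= opp (q `&` opp r).
Proof. by rewrite le_meet_pseudocompl -meetA pseudocompl. Qed.

Lemma pseudocompl_is_heyting : is_heyting L.
Proof. by exists (fun q r => opp (q `&` opp r)); exact: pseudocompl_impE. Qed.

(** De Morgan, without distributivity: [opp (p]|[opp p)] lies below both [opp p] and [opp (opp p)],
    whose meet is [\bot]. *)
Lemma join_pseudocompl p : p `|` opp p = \top.
Proof.
apply: le_anti; rewrite lex1 /=; apply/le_meet_pseudocompl; rewrite meet1x.
apply: le_anti; rewrite le0x andbT -(meet_pseudocompl (opp p)) lexI.
by apply/andP; split; apply/pseudocompl; apply: le_anti;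
   rewrite le0x andbT -(meet_pseudocompl (p `|` opp p)) meetC leI2 ?leUl ?leUr.
Qed.

End PseudoComplement.

(** Meeting with a fixed element is left adjoint to implication, so it preserves joins. *)
Lemma heyting_meetUl (d : Order.disp_t) (L : tbLatticeType d) :
  is_heyting L -> left_distributive (@Order.meet d L) (@Order.join d L).
Proof.
case=> imp impE r p q; apply: le_anti; apply/andP; split.
  apply/impE; rewrite leUx; apply/andP.
  by split; apply/impE; rewrite (leUl, leUr).
by rewrite leUx !leI2 ?leUl ?leUr.
Qed.

Lemma involutive_pseudocompl_is_boolean_with (d : Order.disp_t)
    (L : tbLatticeType d) (opp : L -> L) :
  (forall p q : L, p `&` q = \bot <-> p <= opp q) ->
  (forall p, opp (opp p) <= p) -> is_boolean_with opp.
Proof.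
move=> pcE oppK; split; first exact/heyting_meetUl/(pseudocompl_is_heyting _ _ opp).
by move=> p; split; [exact: meet_pseudocompl | exact: join_pseudocompl].
Qed.

Section Overlap.
Variables (d : Order.disp_t) (L : tbLatticeType d).
Variables (ov : L -> L -> Prop) (opp : L -> L).
Hypothesis ooL : is_oo_lattice ov opp.

(** [\bot] is the join of the empty family, so splitting would yield an index in [False]. *)
Lemma overlap_bot p : ~ ov p \bot.
Proof.
have lub0 : isLub (range (fun i : False => match i with end : L)) \bot.
  by split=> [_ [[]]|x _]; rewrite ?le0x.
by case/(oo_split ooL lub0 p)=> -[].
Qed.

(** When [q <= r], the join of the pair [q], [r] is [r], and splitting applies to it. *)
Lemma overlap_le p q r : q <= r -> ov p q -> ov p r.
Proof.
move=> le_qr ov_pq.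
have lub_r : isLub (range (fun b : bool => if b then q else r)) r.
  split=> [_ [[] _ <-]|x] //=.
  by apply; exists false.
by apply/(oo_split ooL lub_r p); exists true.
Qed.

(** If some [x] overlaps [r], then [r] overlaps [r]&[x] and hence [r]. So if [r] does not overlap
    itself, nothing overlaps it, and density vacuously gives [r <= \bot]. *)
Lemma overlap_refl r : r <> \bot -> ov r r.
Proof.
move=> r_neq0; apply: contrapT => not_ov; apply: r_neq0.
apply: le_anti; rewrite le0x andbT; apply: (oo_density ooL) => x ov_xr.
case: not_ov; apply: (overlap_le _ (r `&` x)); first exact: leIl.
exact/(oo_meet ooL)/(oo_sym ooL).
Qed.

Lemma overlapE p q : ov p q <-> p `&` q <> \bot.
Proof.
split=> [/(oo_meet ooL) ov_pq eq0|/overlap_refl ov_pq].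
  by move: ov_pq; rewrite eq0; exact: overlap_bot.
(* The meet overlaps itself; each side is enlarged in turn, to [q] and then, by symmetry, to [p]. *)
apply: (overlap_le _ (p `&` q)); first exact: leIr.
apply: (oo_sym ooL); apply: (overlap_le _ (p `&` q)) => //; exact: leIl.
Qed.

Lemma overlap_oppK p : opp (opp p) <= p.
Proof.
have pcE := oo_pseudocompl ooL.
(* If [r] met [p] in [\bot], it would lie below [opp p] and so could not overlap [opp (opp p)]. *)
apply: (oo_density ooL) => r /overlapE r_neq0; apply/overlapE => /pcE le_r.
apply: r_neq0; apply: le_anti; rewrite le0x andbT.
by rewrite -(meet_pseudocompl _ _ _ pcE (opp p)) leI2.
Qed.

End Overlap.

Section Boolean.
Variables (d : Order.disp_t) (L : tbLatticeType d) (compl : L -> L).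
Hypothesis boolL : is_boolean_with compl.

Lemma boolean_pseudocompl p q : p `&` q = \bot <-> p <= compl q.
Proof.
case: boolL => meetUl_L complE; split=> [eq0|le_p].
  have -> : p = p `&` compl q; last exact: leIr.
  (* Split [p] along [\top = q]|[compl q]; the part inside [q] vanishes. *)
  rewrite -[LHS]meet1x -(complE q).2 meetUl_L.
  by rewrite [q `&` p]meetC eq0 join0x meetC.
by apply: le_anti; rewrite le0x andbT -(complE q).1 meetC leI2.
Qed.

Lemma boolean_complK p : compl (compl p) <= p.
Proof.
case: boolL => meetUl_L complE.
have -> : compl (compl p) = p `&` compl (compl p); last exact: leIl.
by rewrite -[LHS]meet1x -(complE p).2 meetUl_L (complE (compl p)).1 joinx0.
Qed.

Lemma boolean_is_oo_lattice :
  is_oo_lattice (fun p q : L => p `&` q <> \bot) compl.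
Proof.
have pcE := boolean_pseudocompl; split=> //.
- by move=> p q; rewrite meetC.
- by move=> p q; rewrite meetA meetxx.
- move=> I q s [ub_s lub_s] p; split=> [ps_neq0|[i pq_neq0] ps0].
    (* If [p] meets every [q i] in [\bot], then [compl p] is an upper bound of the family, hence
       above [s]. *)
    apply: contrapT => no_i; apply: ps_neq0; rewrite meetC; apply/pcE.
    apply: lub_s => _ [i _ <-]; apply/pcE; rewrite meetC.
    by apply: contrapT => pq_neq0; apply: no_i; exists i.
  apply: pq_neq0; apply: le_anti; rewrite le0x andbT -ps0 leI2 //.
  by apply: ub_s; exists i.
(* The test element for density is [compl q]: were [p]&[compl q] nonzero, [compl q] would overlap
   [p], hence [q]. *)
- move=> p q dens; apply/(le_meet_pseudocompl _ _ _ pcE boolean_complK).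
  apply: contrapT => neq0; apply: (dens (compl q)); first by rewrite meetC.
  by rewrite meetC (meet_pseudocompl _ _ _ pcE).
(* The whole lattice is a base: [p] is itself the greatest member of the family it should be the
   join of. *)
- exists setT => p; split=> [x [] //|x]; apply.
  by split.
Qed.

End Boolean.

Theorem proposition4p14 (d : Order.disp_t) (L : tbLatticeType d) :
  (forall (ov : L -> L -> Prop) (opp : L -> L), is_oo_lattice ov opp ->
     [/\ is_oHa ov opp,
         is_oBa ov opp,
         is_boolean_with opp
       & forall p q : L, ov p q <-> p `&` q <> \bot]) /\
  (forall compl : L -> L, is_boolean_with compl ->
     let ov := fun p q : L => p `&` q <> \bot in
     [/\ is_oBa ov compl, is_oHa ov compl & is_oo_lattice ov compl]).
Proof.
split=> [ov opp ooL|compl boolL ov].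
  have pcE := oo_pseudocompl ooL; have oppK := overlap_oppK _ _ _ _ ooL.
  have boolL := involutive_pseudocompl_is_boolean_with _ _ _ pcE oppK.
  have oHaL : is_oHa ov opp.
    by split=> //; exact: pseudocompl_is_heyting pcE oppK.
  by split=> //; [split=> //; exists opp | exact: overlapE ooL].
have ooL : is_oo_lattice ov compl := boolean_is_oo_lattice _ _ _ boolL.
have oHaL : is_oHa ov compl.
  split=> //; apply: pseudocompl_is_heyting (boolean_pseudocompl _ _ _ boolL) _.
  exact: boolean_complK.
by split=> //; split=> //; exists compl.
Qed.
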